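(* Let $X$ and $Y$ be Banach spaces and let $(S,T)\in RP(X,Y)$ be a regular Fredholm pair whose number is $1$. Then there is an adapted decomposition system $(X_1,X_2,\tilde X;Y_1,Y_2,\tilde Y)$ of $(S,T)$ such that, for the subspaces $X_2^n,Y_2^n,\mathbb{N}^n,\mathbb{M}^n,\tilde X_N,\tilde Y_N$ associated with it, the following hold (every map ''$\xrightarrow{\cong}$'' being the indicated restriction of $S$ or $T$, and an isomorphism of Banach spaces). (I-1) If the case of $(S,T)$ is $I-1$, then $$X=X_1\oplus X_2^2,\qquad Y=Y_1\oplus Y_2^2,$$ $S|_{X_1}\equiv 0$, $S|_{X_2^2}\colon X_2^2\xrightarrow{\cong}Y_2^2$, $T|_{Y_1}\equiv 0$, $T|_{Y_2^2}\colon Y_2^2\xrightarrow{\cong}X_2^2$. (II-1) If the case of $(S,T)$ is $II-1$, then $$X=[X_1\oplus\mathbb{N}^1]\oplus X_2^2,\qquad Y=Y_1\oplus Y_2^2\oplus\tilde Y_N,$$ $S|_{X_1\oplus\mathbb{N}^1}\equiv 0$, $S|_{X_2^2}\colon X_2^2\xrightarrow{\cong}Y_2^2$, $T|_{Y_1}\equiv 0$, $T|_{Y_2^2}\colon Y_2^2\xrightarrow{\cong}X_2^2$, $T|_{\tilde Y_N}\colon\tilde Y_N\xrightarrow{\cong}\mathbb{N}^1$. (III-1) If the case of $(S,T)$ is $III-1$, then $$X=X_1\oplus X_2^2\oplus\tilde X_N,\qquad Y=[Y_1\oplus\mathbb{M}^1]\oplus Y_2^2,$$ $S|_{X_1}\equiv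 0$, $S|_{X_2^2}\colon X_2^2\xrightarrow{\cong}Y_2^2$, $S|_{\tilde X_N}\colon\tilde X_N\xrightarrow{\cong}\mathbb{M}^1$, $T|_{Y_1\oplus\mathbb{M}^1}\equiv 0$, $T|_{Y_2^2}\colon Y_2^2\xrightarrow{\cong}X_2^2$.
   Context: $L(X,Y)$ is the space of bounded linear operators from $X$ to $Y$; $N(\cdot)$ and $R(\cdot)$ denote null space and range; $\mathbb N=\{1,2,\dots\}$, $\mathbb N_0=\mathbb N\cup\{0\}$. Regular Fredholm pairs. For $S\in L(X,Y)$, $T\in L(Y,X)$, $(S,T)$ is a Fredholm pair if $N(S)/(N(S)\cap R(T))$, $R(T)/(N(S)\cap R(T))$, $N(T)/(N(T)\cap R(S))$, $R(S)/(N(T)\cap R(S))$ are all finite dimensional. An operator $T\in L(Y,X)$ is regular if $T=TT'T$ for some $T'\in L(X,Y)$. $RP(X,Y)$ is the set of Fredholm pairs $(S,T)$ with both $S$ and $T$ regular. Number and case. Put $R_{S,0}=Y$, $R_{T,0}=X$, $R_{S,n+1}=S(R_{T,n})$, $R_{T,n+1}=T(R_{S,n})$ for $n\in\mathbb N_0$. These are decreasing sequences of subspaces, finite dimensional for $n\ge 2$. Let $p$ (resp. $q$) be the smallest element of $\mathbb N$ with $R_{S,p}=R_{S,p+k}$ (resp. $R_{T,q}=R_{T,q+k}$) for all $k\ge 0$; always $|p-q|\le 1$. The number of $(S,T)$ is $n=\min\{p,q\}$, and its case is $I-n$ if $p=q$, $II-n$ if $p<q$, $III-n$ if $q<p$.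 Decomposition systems. A decomposition system of $(S,T)\in RP(X,Y)$ consists of finite dimensional subspaces $X_1,X_2\subseteq X$, $Y_1,Y_2\subseteq Y$ and closed subspaces $\tilde X\subseteq X$, $\tilde Y\subseteq Y$ with $N(S)=(N(S)\cap R(T))\oplus X_1$, $R(T)=(N(S)\cap R(T))\oplus X_2$, $X=((N(S)\cap R(T))\oplus X_1\oplus X_2)\oplus\tilde X$, $N(T)=(N(T)\cap R(S))\oplus Y_1$, $R(S)=(N(T)\cap R(S))\oplus Y_2$, $Y=((N(T)\cap R(S))\oplus Y_1\oplus Y_2)\oplus\tilde Y$. With it are associated, for $n\in\mathbb N$: $M^n=R_{S,n}\cap N(T)$, $N^n=R_{T,n}\cap N(S)$, $Y_2^n=R_{S,n}\cap Y_2$, $X_2^n=R_{T,n}\cap X_2$; $R_{\tilde S,1}=S(\tilde X)$, $R_{\tilde T,1}=T(\tilde Y)$, $R_{\tilde S,n+1}=S(R_{\tilde T,n})$, $R_{\tilde T,n+1}=T(R_{\tilde S,n})$; $\mathbb M^n=R_{\tilde S,n}\cap N(T)$, $\mathbb N^n=R_{\tilde T,n}\cap N(S)$, $\mathbb Y_2^n=R_{\tilde S,n}\cap Y_2^n$, $\mathbb X_2^n=R_{\tilde T,n}\cap X_2^n$ (here $\mathbb N^n$ is a subspace of $X$, not a power of the natural numbers); $\tilde X_N=\{x\in\tilde X: Sx\in\mathbb M^1\}$, $\tilde X_2=\{x\in\tilde X: Sx\in\mathbb Y_2^1\}$, $\tilde Y_N=\{y\in\tilde Y: Ty\in\mathbb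 N^1\}$, $\tilde Y_2=\{y\in\tilde Y: Ty\in\mathbb X_2^1\}$. The system is called adapted if for all $n\in\mathbb N$: $R_{S,n}=M^n\oplus Y_2^n$, $R_{T,n}=N^n\oplus X_2^n$, $R_{\tilde S,n}=\mathbb M^n\oplus\mathbb Y_2^n$, $R_{\tilde T,n}=\mathbb N^n\oplus\mathbb X_2^n$, $R_{S,n}=R_{S,n+1}\oplus R_{\tilde S,n}$, $R_{T,n}=R_{T,n+1}\oplus R_{\tilde T,n}$. *)

(* Defs.v *)
From HB Require Import structures.
From mathcomp Require Import all_boot all_order all_algebra.
From mathcomp Require Import all_classical all_reals all_analysis.
From mathcomp Require Import complex.

Set Implicit Arguments.
Unset Strict Implicit.
Unset Printing Implicit Defensive.

Import Order.TTheory GRing.Theory Num.Theory.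
Import numFieldNormedType.Exports.

Local Open Scope classical_set_scope.
Local Open Scope ring_scope.

Variant real_or_complex : numFieldType -> Prop :=
| scalars_real (R : realType) : real_or_complex R
| scalars_complex (R : realType) : real_or_complex R[i].

Section LinearAlgebra.
Context {K : numFieldType} {V : lmodType K}.
Implicit Types (A B : set V) (Bs : seq (set V)).

Definition linear_subspace A : Prop := GRing.submod_closed [in A].

Definition span_of n (e : 'I_n -> V) : set V :=
  [set x | exists c : 'I_n -> K, x = \sum_(i < n) c i *: e i].

Definition finite_dim A : Prop :=
  exists (n : nat) (e : 'I_n -> V), A = span_of e.

Definition add_set A B : set V := [set a + b | a in A & b in B].

(* For subspaces B `<=` A, the quotient A / B has finite dimension iff it is
   spanned by the classes of finitely many vectors e i of A. *)
Definition finite_dim_quot A B : Prop :=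
  exists (n : nat) (e : 'I_n -> V),
    (forall i, A (e i)) /\ A = add_set B (span_of e).

Definition sum_sets Bs : set V := foldr add_set [set 0] Bs.

Fixpoint independent Bs : Prop :=
  if Bs is B :: Bs' then B `&` sum_sets Bs' = [set 0] /\ independent Bs'
  else True.

(* A is the (internal, algebraic) direct sum of the subspaces listed in Bs. *)
Definition direct_sum A Bs : Prop := A = sum_sets Bs /\ independent Bs.

End LinearAlgebra.

Definition null_space {K : numFieldType} {U V : lmodType K} (f : U -> V)
  : set U := f @^-1` [set 0].

(* The alternating iterates of two maps f : U -> V and g : V -> U:
   alt_range f g A B 0 = B and alt_range f g A B n+1 = f (alt_range g f B A n).
   So alt_range S T setT setT n is R_{S,n}, and for n >= 1
   alt_range S T Xt Yt n is R_{S~,n}, starting from R_{S~,1} = S(Xt). *)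
Fixpoint alt_range {U V : Type} (f : U -> V) (g : V -> U)
    (A : set U) (B : set V) (n : nat) : set V :=
  if n is m.+1 then f @` alt_range g f B A m else B.

Section FredholmPairs.
Context {K : numFieldType} {X Y : normedModType K}.
Implicit Types (S : X -> Y) (T : Y -> X).

Definition fredholm_pair S T : Prop :=
  [/\ finite_dim_quot (null_space S) (null_space S `&` range T),
      finite_dim_quot (range T) (null_space S `&` range T),
      finite_dim_quot (null_space T) (null_space T `&` range S) &
      finite_dim_quot (range S) (null_space T `&` range S)].

End FredholmPairs.

(* For linear operators, boundedness on a neighbourhood of 0 is the operator
   bound `|f x| <= r * `|x| (linear_boundedP). *)
Definition bounded_operator {K : numFieldType} {U V : normedModType K}
    (f : {linear U -> V}) : Prop := bounded_near f (nbhs (0 : U)).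

Definition regular {K : numFieldType} {U V : normedModType K}
    (f : {linear U -> V}) : Prop :=
  exists2 g : {linear V -> U}, bounded_operator g & f =1 f \o g \o f.

Definition regular_fredholm_pair {K : numFieldType} {X Y : normedModType K}
    (S : {linear X -> Y}) (T : {linear Y -> X}) : Prop :=
  [/\ bounded_operator S, bounded_operator T, fredholm_pair S T,
      regular S & regular T].

Definition stabilizes_at {V : Type} (F : nat -> set V) (p : nat) : Prop :=
  (0 < p)%N /\ forall k, F p = F (p + k)%N.

Definition stabilization_index {V : Type} (F : nat -> set V) (p : nat) : Prop :=
  stabilizes_at F p /\ forall p', stabilizes_at F p' -> (p <= p')%N.

Variant pair_case := CaseI | CaseII | CaseIII.

Definition case_of_indices (p q : nat) : pair_case :=
  if p == q then CaseI else if (p < q)%N then CaseII else CaseIII.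

Section NumberCase.
Context {U V : Type} (S : U -> V) (T : V -> U).

Definition stabilization_indices (p q : nat) : Prop :=
  stabilization_index (alt_range S T setT setT) p /\
  stabilization_index (alt_range T S setT setT) q.

Definition has_number (n : nat) : Prop :=
  exists p q, stabilization_indices p q /\ n = minn p q.

Definition has_case (c : pair_case) (n : nat) : Prop :=
  exists p q,
    [/\ stabilization_indices p q, n = minn p q & c = case_of_indices p q].

End NumberCase.

Record decomposition (X Y : Type) := Decomposition {
  dX1 : set X; dX2 : set X; dXt : set X;
  dY1 : set Y; dY2 : set Y; dYt : set Y }.

Section DecompositionSystems.
Context {K : numFieldType} {X Y : normedModType K}.
Variables (S : X -> Y) (T : Y -> X) (D : decomposition X Y).

Definition is_decomposition_system : Prop :=
  [/\ [/\ linear_subspace (dX1 D), linear_subspace (dX2 D),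
          linear_subspace (dY1 D) & linear_subspace (dY2 D)],
      [/\ finite_dim (dX1 D), finite_dim (dX2 D),
          finite_dim (dY1 D) & finite_dim (dY2 D)],
      [/\ linear_subspace (dXt D), closed (dXt D),
          linear_subspace (dYt D) & closed (dYt D)],
      [/\ direct_sum (null_space S) [:: null_space S `&` range T; dX1 D],
          direct_sum (range T) [:: null_space S `&` range T; dX2 D] &
          direct_sum setT
            [:: null_space S `&` range T; dX1 D; dX2 D; dXt D]] &
      [/\ direct_sum (null_space T) [:: null_space T `&` range S; dY1 D],
          direct_sum (range S) [:: null_space T `&` range S; dY2 D] &
          direct_sum setT
            [:: null_space T `&` range S; dY1 D; dY2 D; dYt D]]].

(* Notation of the associated subspaces: RS, RT are R_{S,n}, R_{T,n}; RSt, RTt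
   are R_{S~,n}, R_{T~,n}; Mn, Nn, Y2n, X2n are M^n, N^n, Y_2^n, X_2^n, and a
   final t marks the blackboard-bold subspaces built from R_{S~,n}, R_{T~,n}.
   XtN, YtN are X~_N, Y~_N. The indexed spaces are meant for n >= 1. *)
Definition RS (n : nat) : set Y := alt_range S T setT setT n.
Definition RT (n : nat) : set X := alt_range T S setT setT n.
Definition Mn (n : nat) : set Y := RS n `&` null_space T.
Definition Nn (n : nat) : set X := RT n `&` null_space S.
Definition Y2n (n : nat) : set Y := RS n `&` dY2 D.
Definition X2n (n : nat) : set X := RT n `&` dX2 D.

Definition RSt (n : nat) : set Y := alt_range S T (dXt D) (dYt D) n.
Definition RTt (n : nat) : set X := alt_range T S (dYt D) (dXt D) n.
Definition Mnt (n : nat) : set Y := RSt n `&` null_space T.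
Definition Nnt (n : nat) : set X := RTt n `&` null_space S.
Definition Y2nt (n : nat) : set Y := RSt n `&` Y2n n.
Definition X2nt (n : nat) : set X := RTt n `&` X2n n.

Definition XtN : set X := dXt D `&` S @^-1` Mnt 1.
Definition YtN : set Y := dYt D `&` T @^-1` Nnt 1.

Definition adapted : Prop :=
  forall n : nat, (0 < n)%N ->
  [/\ direct_sum (RS n) [:: Mn n; Y2n n],
      direct_sum (RT n) [:: Nn n; X2n n],
      direct_sum (RSt n) [:: Mnt n; Y2nt n],
      direct_sum (RTt n) [:: Nnt n; X2nt n] &
      direct_sum (RS n) [:: RS n.+1; RSt n] /\
      direct_sum (RT n) [:: RT n.+1; RTt n]].

End DecompositionSystems.

Definition vanishes_on {U : Type} {V : nmodType} (f : U -> V) (A : set U)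
  : Prop := forall x, A x -> f x = 0.

(* For a linear map f and subspaces A, B of Banach spaces: A and B are closed,
   hence Banach, and f restricts to a linear homeomorphism of A onto B. *)
Definition banach_iso {K : numFieldType} {U V : normedModType K}
    (f : {linear U -> V}) (A : set U) (B : set V) : Prop :=
  [/\ closed A, closed B, set_bij A B f, {within A, continuous f} &
      exists2 g : V -> U, {in A, cancel f g} & {within B, continuous g}].

(* Main.v *)
Require Import Defs.
From mathcomp Require Import all_boot all_order all_algebra.
From mathcomp Require Import all_classical all_reals all_analysis.
From mathcomp Require Import zify.
Import numFieldNormedType.Exports.
Local Open Scope classical_set_scope.
Local Open Scope ring_scope.

Set Implicit Arguments.
Unset Strict Implicit.
Unset Printing Implicit Defensive.
Import GRing.Theory.

(** The number being 1 means that p = 1 or q = 1.  Exchanging S and T exchanges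
    p with q, X with Y and case II with case III, so suppose that p = 1.  Then
    B = R(S) = S(T(S(X))), and B is the image under S of R(T) / (N(S) /\ R(T)),
    hence finite dimensional.  So ST maps B onto itself and is bijective on it,
    and by Cayley-Hamilton ([surjective_inverse_poly]) its inverse there is the
    restriction of a polynomial U in ST, which is continuous on all of Y.

    With A = T(B), the maps S : A -> B and T : B -> A are therefore
    bijections, with the continuous inverses TU and US, and A, B are closed as
    the fixed point sets of TUS and STU.  Put N = N(S) /\ R(T).  Since
    S(A) = R(S), we get X = N(S) (+) A and R(T) = N (+) A
    ([source_decomposition], [range_decomposition]), while T is injective on B,
    so that N(T) meets R(S) trivially.  Regularity of T, say T = TT'T, gives the
    closed complement ker (1 - T'T) of N(T); the part Y~ of it that is
    annihilated by ST is mapped by T bijectively onto N, with inverse T', and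
    Y = N(T) (+) B (+) Y~ ([target_decomposition]).

    The system is then (X_1, A, 0; N(T), B, Y~) with X_1 any complement of N in
    N(S).  Its associated subspaces are computed outright: R_{S,n} = B,
    R_{S~,n} = 0, R_{T,1} = R(T), R_{T~,1} = N, and R_{T,n} = A, R_{T~,n} = 0
    for n >= 2.  This makes it adapted and turns X = X_1 (+) N (+) A and
    Y = N(T) (+) B (+) Y~ into the splitting of case II; if moreover
    R(T) = A then N = 0 and Y~ = 0, which is case I. *)

(** * Subspaces and internal direct sums *)

Section Subspaces.
Context {K : numFieldType} {V : lmodType K}.
Implicit Types A B C D : set V.

Lemma linear_subspaceP A :
  linear_subspace A <->
  A 0 /\ forall a u v, A u -> A v -> A (a *: u + v).
Proof.
split=> [[A0 Al]|[A0 Al]].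
  split; first exact: set_mem A0.
  by move=> a u v Au Av; apply/set_mem/Al; apply/mem_set.
split; first exact/mem_set.
by move=> a u v /set_mem Au /set_mem Av; apply/mem_set/Al.
Qed.

Lemma subspace0 A : linear_subspace A -> A 0.
Proof. by move=> /linear_subspaceP[]. Qed.

Lemma subspaceD A u v : linear_subspace A -> A u -> A v -> A (u + v).
Proof.
by move=> /linear_subspaceP[_ /(_ 1)] Al *; rewrite -[u]scale1r; apply: Al.
Qed.

Lemma subspaceZ A a u : linear_subspace A -> A u -> A (a *: u).
Proof.
by move=> /linear_subspaceP[A0 Al] Au; rewrite -[_ *: _]addr0; apply: Al.
Qed.

Lemma subspaceN A u : linear_subspace A -> A u -> A (- u).
Proof. by move=> lA Au; rewrite -scaleN1r; apply: subspaceZ. Qed.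

Lemma subspaceB A u v : linear_subspace A -> A u -> A v -> A (u - v).
Proof. by move=> lA Au Av; apply: subspaceD => //; apply: subspaceN. Qed.

Lemma subspace_sum A n (F : 'I_n -> V) :
  linear_subspace A -> (forall i, A (F i)) -> A (\sum_(i < n) F i).
Proof.
move=> lA AF; elim/big_ind: _ => // [|u v]; first exact: subspace0.
exact: subspaceD.
Qed.

Lemma subspace_set0 : linear_subspace ([set 0] : set V).
Proof.
by apply/linear_subspaceP; split=> // a u v -> ->; rewrite scaler0 addr0.
Qed.

Lemma subspaceI A B :
  linear_subspace A -> linear_subspace B -> linear_subspace (A `&` B).
Proof.
move=> /linear_subspaceP[A0 Al] /linear_subspaceP[B0 Bl].
apply/linear_subspaceP; split=> // a u v [Au Bu] [Av Bv].
by split; [apply: Al|apply: Bl].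
Qed.

Lemma subspace_add A B :
  linear_subspace A -> linear_subspace B -> linear_subspace (add_set A B).
Proof.
move=> lA lB; apply/linear_subspaceP; split.
  by exists 0; [exact: subspace0|exists 0; [exact: subspace0|rewrite addr0]].
move=> a _ _ [u Au [v Bv <-]] [u' Au' [v' Bv' <-]].
exists (a *: u + u'); first by apply: subspaceD => //; apply: subspaceZ.
exists (a *: v + v'); first by apply: subspaceD => //; apply: subspaceZ.
by rewrite scalerDr addrACA.
Qed.

Lemma subspace_span n (e : 'I_n -> V) : linear_subspace (span_of e).
Proof.
apply/linear_subspaceP; split.
  by exists (fun=> 0); rewrite big1 // => i _; rewrite scale0r.
move=> a _ _ [c ->] [d ->]; exists (fun i => a * c i + d i).
rewrite scaler_sumr -big_split /=; apply: eq_bigr => i _.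
by rewrite scalerDl scalerA.
Qed.

Lemma add_set0 A : add_set A [set 0] = A.
Proof.
apply/seteqP; split=> [_ [a Aa [_ -> <-]]|a Aa]; first by rewrite addr0.
by exists a => //; exists 0 => //; rewrite addr0.
Qed.

Lemma add_setA A B C : add_set A (add_set B C) = add_set (add_set A B) C.
Proof.
apply/seteqP; split=> [_ [a Aa [_ [b Bb [c Cc <-]] <-]]|].
  by exists (a + b); [exists a => //; exists b|exists c => //; rewrite addrA].
move=> _ [_ [a Aa [b Bb <-]] [c Cc <-]].
by exists a => //; exists (b + c); [exists b => //; exists c|rewrite addrA].
Qed.

Lemma add_setC A B : add_set A B = add_set B A.
Proof.
by apply/seteqP; split=> _ [a Aa [b Bb <-]]; exists b => //; exists a => //;
  rewrite addrC.
Qed.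

Lemma add_set0l A : add_set [set 0] A = A.
Proof. by rewrite add_setC add_set0. Qed.

Lemma direct_sum2 A B C :
  linear_subspace B -> linear_subspace C ->
  A = add_set B C -> (forall x, B x -> C x -> x = 0) ->
  direct_sum A [:: B; C].
Proof.
move=> lB lC AE BC; rewrite /direct_sum /= !add_set0.
split=> //; split; last split=> //.
  apply/seteqP; split=> [x [Bx Cx]|_ ->]; first exact: BC.
  by split; exact: subspace0.
apply/seteqP; split=> [x []//|_ ->]; split=> //; exact: subspace0.
Qed.

Lemma direct_sum_swap A B C :
  direct_sum A [:: B; C] -> direct_sum A [:: C; B].
Proof.
rewrite /direct_sum /= !add_set0 => -[-> [BC [C0 _]]].
have [B0 C0'] : (B `&` C) 0 by rewrite BC.
split; first exact: add_setC.
split; first by rewrite setIC.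
by split=> //; apply/seteqP; split=> [x []//|_ ->].
Qed.

(** If c = d + s with c in C, d in D and s in the sum of Bs, then s = c - d
    also lies in B, hence s = 0 and c = d. *)
Lemma direct_sum_refine A B C D Bs :
  linear_subspace C -> linear_subspace D ->
  direct_sum A (B :: Bs) -> direct_sum B [:: C; D] ->
  direct_sum A [:: C, D & Bs].
Proof.
move=> lC lD [AE [BBs iBs]] [BE [CD _]].
have {}BE : B = add_set C D by rewrite BE /= add_set0.
have {}CD : C `&` D = [set 0] by move: CD; rewrite /= add_set0.
have [_ Bs0] : (B `&` sum_sets Bs) 0 by rewrite BBs.
rewrite /direct_sum /= add_setA -BE; split=> //; split; last split=> //.
  apply/seteqP; split=> [x [Cx [d Dd [s ss xE]]]|_ ->]; last first.
    split; first exact: subspace0.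
    by exists 0; [exact: subspace0|exists 0; rewrite ?addr0].
  have s0 : (B `&` sum_sets Bs) s.
    split=> //; rewrite BE; exists x => //.
    exists (- d); first exact: subspaceN.
    by rewrite -xE addrAC subrr add0r.
  rewrite -CD; split=> //; rewrite BBs in s0.
  by move: xE; rewrite s0 addr0 => <-.
apply/seteqP; split=> [x [Dx sx]|_ ->]; last by split=> //; exact: subspace0.
rewrite -BBs; split=> //; rewrite BE; exists 0; first exact: subspace0.
by exists x => //; rewrite add0r.
Qed.

Lemma direct_sum_merge A B C D :
  direct_sum A [:: B; C; D] -> direct_sum A [:: B; add_set C D].
Proof.
rewrite /direct_sum /= !add_set0 => -[-> [BCD [CD [D0 _]]]].
split=> //; split=> //; split=> //; apply/seteqP; split=> [x []//|_ ->].
by have [_ ?] : (B `&` add_set C D) 0 by rewrite BCD.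
Qed.

Lemma direct_sum_cons0 A Bs :
  A 0 -> direct_sum A ([set 0] :: Bs) <-> direct_sum A Bs.
Proof.
rewrite /direct_sum /= add_set0l => A0; split=> [[-> []//]|[AE iBs]].
split=> //=; split=> //; rewrite -AE; apply/seteqP; split=> [x []//|_ ->//].
Qed.

Lemma direct_sum_rcons0 A Bs :
  direct_sum A (rcons Bs [set 0]) <-> direct_sum A Bs.
Proof.
have sumE Cs : sum_sets (rcons Cs [set 0]) = sum_sets Cs :> set V.
  by elim: Cs => [|C Cs IH] /=; [rewrite add_set0|rewrite IH].
have indE Cs : independent (rcons Cs [set 0] : seq (set V)) <-> independent Cs.
  elim: Cs => [|C Cs IH] /=; first by rewrite setIid.
  by rewrite sumE; split=> -[? ?]; split=> //; apply/IH.
by rewrite /direct_sum sumE; split=> -[? ?]; split=> //; apply/indE.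
Qed.

Lemma direct_sum_0l A : linear_subspace A -> direct_sum A [:: [set 0]; A].
Proof.
move=> lA; apply: direct_sum2 => //; first exact: subspace_set0.
by rewrite add_set0l.
Qed.

Lemma direct_sum_0r A : linear_subspace A -> direct_sum A [:: A; [set 0]].
Proof. by move=> /direct_sum_0l/direct_sum_swap. Qed.

End Subspaces.

Section LinearMaps.
Context {K : numFieldType} {V W : lmodType K} (f : {linear V -> W}).

Lemma subspace_image (A : set V) :
  linear_subspace A -> linear_subspace (f @` A).
Proof.
move=> lA; apply/linear_subspaceP; split.
  by exists 0; [exact: subspace0|exact: linear0].
move=> a _ _ [u Au <-] [v Av <-]; exists (a *: u + v); last exact: linearP.
by apply: subspaceD => //; apply: subspaceZ.
Qed.

Lemma subspace_range : linear_subspace (range f).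
Proof. by apply: subspace_image; apply/linear_subspaceP. Qed.

Lemma subspace_kernel : linear_subspace (null_space f).
Proof.
apply/linear_subspaceP; split; first exact: linear0.
by move=> a u v fu fv; rewrite /null_space /= linearP fu fv scaler0 addr0.
Qed.

End LinearMaps.

(** * Finite dimension *)

Section FiniteDimension.
Context {K : numFieldType} {V W : lmodType K}.
Implicit Types (A B C : set V).

Lemma span_of_split m n (e : 'I_(m + n) -> V) :
  span_of e = add_set (span_of (e \o @lshift m n)) (span_of (e \o @rshift m n)).
Proof.
apply/seteqP; split=> [_ [c ->]|].
  exists (\sum_(i < m) c (lshift n i) *: e (lshift n i)).
    by exists (c \o @lshift m n).
  exists (\sum_(i < n) c (rshift m i) *: e (rshift m i)).
    by exists (c \o @rshift m n).
  by rewrite big_split_ord.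
move=> _ [_ [c ->] [_ [d ->] <-]].
exists (fun i => match fintype.split i with inl j => c j | inr k => d k end).
rewrite big_split_ord; congr (_ + _); apply: eq_bigr => i _.
  by rewrite (unsplitK (inl i)).
by rewrite (unsplitK (inr i)).
Qed.

Lemma finite_dim_add A B :
  finite_dim A -> finite_dim B -> finite_dim (add_set A B).
Proof.
move=> [m [e ->]] [n [e' ->]].
exists (m + n)%N,
  (fun i => match fintype.split i with inl j => e j | inr k => e' k end).
rewrite span_of_split; apply: congr2; congr span_of; apply/funext => i /=.
  by rewrite (unsplitK (inl i)).
by rewrite (unsplitK (inr i)).
Qed.

Lemma finite_dim0 : finite_dim ([set 0] : set V).
Proof.
exists 0%N, (fun=> 0); apply/seteqP; split=> [_ ->|_ [c ->]] /=.
  by exists (fun=> 0); rewrite big_ord0.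
by rewrite big_ord0.
Qed.

Lemma finite_dim_image (f : {linear V -> W}) A :
  finite_dim A -> finite_dim (f @` A).
Proof.
move=> [n [e ->]]; exists n, (f \o e); apply/seteqP; split.
  move=> _ [_ [c ->] <-]; exists c.
  by rewrite linear_sum; apply: eq_bigr => i _; rewrite linearZ.
move=> _ [c ->]; exists (\sum_(i < n) c i *: e i); first by exists c.
by rewrite linear_sum; apply: eq_bigr => i _; rewrite linearZ.
Qed.

(** Complements are built one spanning vector at a time: a vector already in
    the sum is discarded, any other contributes its line. *)
Lemma complement_of_span n (e : 'I_n -> V) B : linear_subspace B ->
  exists C, [/\ linear_subspace C, finite_dim C &
    direct_sum (add_set B (span_of e)) [:: B; C]].
Proof.
elim: n => [|n IH] in e B * => lB.
  exists [set 0]; split; [exact: subspace_set0|exact: finite_dim0|].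
  have -> : span_of e = [set 0].
    apply/seteqP; split=> [_ [c ->]|_ ->]; first by rewrite big_ord0.
    by exists (fun=> 0); rewrite big_ord0.
  by rewrite add_set0; exact: direct_sum_0r.
pose L := span_of ((e : 'I_(1 + n) -> V) \o @lshift 1 n).
have lL : linear_subspace L by exact: subspace_span.
have LP x : L x <-> exists a, x = a *: e (lshift n (ord0 : 'I_1)).
  split=> [[c ->]|[a ->]]; first by exists (c ord0); rewrite big_ord1.
  by exists (fun=> a); rewrite big_ord1.
rewrite (span_of_split (m := 1) (e : 'I_(1 + n) -> V)) add_setA -/L.
have [C [lC fC dC]] :=
  IH ((e : 'I_(1 + n) -> V) \o @rshift 1 n) _ (subspace_add lB lL).
have [Be|Be] := pselect (B (e (lshift n (ord0 : 'I_1)))).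
  suff BL : add_set B L = B by rewrite BL in dC *; exists C.
  apply/seteqP; split=> [_ [b Bb [_ /LP[a ->] <-]]|b Bb].
    by apply: subspaceD => //; apply: subspaceZ.
  by exists b => //; exists 0; [exact: subspace0|rewrite addr0].
exists (add_set L C); split; first exact: subspace_add.
  by apply: finite_dim_add => //; do 2 eexists.
apply: direct_sum_merge; apply: (direct_sum_refine lB lL dC).
apply: direct_sum2 => // x Bx /LP[a xE]; move: Bx; rewrite xE => Bx.
have [->|a0] := eqVneq a 0; first by rewrite scale0r.
by case: Be; rewrite -[e _]scale1r -(mulVf a0) -scalerA; apply: subspaceZ.
Qed.

Lemma finite_dim_quot_complement A B :
  linear_subspace B -> finite_dim_quot A B ->
  exists C, [/\ linear_subspace C, finite_dim C & direct_sum A [:: B; C]].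
Proof. by move=> lB [n [e [_ ->]]]; exact: complement_of_span. Qed.

(** The inverse of a surjective endomorphism of a finite dimensional space is
    a polynomial in it. If the matrix L expresses the spanning vectors e in
    terms of their images, then L^k f^k(e) = e, so that applying f^n to the
    Cayley-Hamilton relation of L, whose leading coefficient is 1, turns it
    into a relation between the f^k(e) in which e itself has coefficient 1. *)
Lemma surjective_inverse_poly (f : {linear V -> V}) B :
  finite_dim B -> f @` B = B ->
  exists (n : nat) (c : 'I_n -> K),
    forall b, B b -> f (\sum_(k < n) c k *: iter k f b) = b.
Proof.
move=> [[|n] [e BE]] fB.
  exists 0%N, (fun=> 0) => b; rewrite BE => -[c ->].
  by rewrite !big_ord0 linear0.
have iterZ k a v : iter k f (a *: v) = a *: iter k f v.
  by elim: k => //= k ->; rewrite linearZ.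
have iter_sum k m (F : 'I_m -> V) :
    iter k f (\sum_(i < m) F i) = \sum_(i < m) iter k f (F i).
  by elim: k => //= k ->; rewrite linear_sum.
have eL i : exists l : 'I_n.+1 -> K, e i = \sum_j l j *: f (e j).
  have : B (e i).
    rewrite BE; exists (fun j => (j == i)%:R).
    rewrite (bigD1 i) //= eqxx scale1r big1 ?addr0 // => j /negPf ->.
    by rewrite scale0r.
  rewrite -fB BE => -[_ [c ->] <-]; exists c.
  by rewrite linear_sum; apply: eq_bigr => j _; rewrite linearZ.
have [l lE] := choice eL.
pose L : 'M[K]_n.+1 := \matrix_(i, j) l i j.
have shift d i : iter d f (e i) = \sum_j L i j *: iter d.+1 f (e j).
  rewrite {1}lE iter_sum; apply: eq_bigr => j _.
  by rewrite mxE iterZ -iterSr.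
(* The matrix L acts on the family (e i) as the inverse of f. *)
have powL k d i : iter d f (e i) = \sum_j (L ^+ k) i j *: iter (k + d) f (e j).
  elim: k => [|k IH] in d i *.
    rewrite expr0 (bigD1 i) //= mxE eqxx scale1r big1 ?addr0 // => j.
    by rewrite eq_sym mxE => /negPf ->; rewrite scale0r.
  rewrite IH exprSr.
  under eq_bigr => j _ do rewrite shift scaler_sumr.
  rewrite exchange_big /=; apply: eq_bigr => j _.
  rewrite -[L ^+ k * L]/(L ^+ k *m L) mxE scaler_suml.
  by apply: eq_bigr => m _; rewrite scalerA.
pose p := char_poly L.
have CH i : \sum_(k < n.+2) p`_k *: iter (n.+1 - k) f (e i) = 0.
  have pL : \sum_(k < n.+2) p`_k *: L ^+ k = 0.
    apply: etrans (Cayley_Hamilton L).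
    rewrite -/p -[in RHS](coefK p) poly_def size_char_poly.
    rewrite [RHS]raddf_sum /=; apply: eq_bigr => k _.
    by rewrite linearZ /= rmorphXn /= horner_mx_X.
  transitivity (\sum_j (\sum_(k < n.+2) p`_k *: L ^+ k) i j
                  *: iter n.+1 f (e j)); last first.
    by rewrite pL big1 // => j _; rewrite mxE scale0r.
  under [RHS]eq_bigr => j _ do rewrite summxE scaler_suml.
  rewrite exchange_big /=; apply: eq_bigr => k _.
  rewrite (powL k) scaler_sumr; apply: eq_bigr => j _.
  by rewrite mxE scalerA subnKC // -ltnS.
exists n.+1, (fun k => - p`_(rev_ord k)) => b; rewrite BE => -[c ->].
rewrite linear_sum /=.
have -> : \sum_(k < n.+1) f (- p`_(rev_ord k)
            *: iter k f (\sum_(i < n.+1) c i *: e i)) =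
          \sum_(i < n.+1) c i
            *: - \sum_(k < n.+1) p`_(rev_ord k) *: iter k.+1 f (e i).
  under eq_bigr => k _ do rewrite iter_sum linearZ /= linear_sum scaler_sumr.
  rewrite exchange_big; apply: eq_bigr => i _ /=.
  rewrite -sumrN scaler_sumr; apply: eq_bigr => k _.
  by rewrite iterZ linearZ /= !scaleNr scalerN !scalerA mulrC.
apply: eq_bigr => i _; congr (_ *: _).
have := CH i; rewrite big_ord_recr /= subnn.
have -> : p`_n.+1 = 1.
  by have /monicP := char_poly_monic L; rewrite lead_coefE size_char_poly.
rewrite scale1r addrC /= => /eqP; rewrite addr_eq0 => /eqP eE; rewrite [RHS]eE.
congr (- _); rewrite (reindex_inj rev_ord_inj) /=; apply: eq_bigr => k _.
have kn : (k <= n)%N by rewrite -ltnS.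
by rewrite subSS -iterS subSS subKn // subSn.
Qed.

End FiniteDimension.

(** * Closed sets and isomorphisms given by continuous maps *)

Lemma closed_zero (K : numFieldType) (V : normedModType K) :
  closed ([set 0] : set V).
Proof. exact/accessible_closed_set1/hausdorff_accessible/norm_hausdorff. Qed.

Lemma closed_equalizer (K : numFieldType) (V W : normedModType K)
    (f g : V -> W) :
  continuous f -> continuous g -> closed [set x | f x = g x].
Proof.
move=> cf cg.
have -> : [set x | f x = g x] = (fun x => f x - g x) @^-1` [set 0].
  apply/seteqP; split=> x /= [fg]; first by rewrite fg subrr.
  by move/eqP: fg; rewrite subr_eq0 => /eqP.
apply: preimage_closed; first by move=> x _; apply: cvgB; [exact: cf|exact: cg].
exact: closed_zero.
Qed.

Lemma continuous_compose (U V W : topologicalType) (f : U -> V) (g : V -> W) :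
  continuous f -> continuous g -> continuous (g \o f).
Proof. by move=> cf cg x; apply: continuous_comp; [exact: cf|exact: cg]. Qed.

Section Closedness.
Context {K : numFieldType} {V W : normedModType K}.

Lemma closed_kernel (f : V -> W) : continuous f -> closed [set x | f x = 0].
Proof. by move=> cf; apply: closed_equalizer => // x; exact: cvg_cst. Qed.

Lemma closed_fixpoints (f : V -> V) :
  continuous f -> closed [set x | f x = x].
Proof. by move=> cf; apply: closed_equalizer => // x; exact: cvg_id. Qed.

Lemma continuous_linear_combination n (c : 'I_n -> K) (F : 'I_n -> V -> W) :
  (forall i, continuous (F i)) ->
  continuous (fun x => \sum_(i < n) c i *: F i x).
Proof.
move=> cF; elim: n => [|n IH] in c F cF *.
  have -> : (fun x => \sum_(i < 0) c i *: F i x) = cst 0.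
    by apply/funext => x; rewrite big_ord0.
  exact: cst_continuous.
have -> : (fun x => \sum_(i < n.+1) c i *: F i x) =
    (fun x => \sum_(i < n) c (widen_ord (leqnSn n) i)
                *: F (widen_ord (leqnSn n) i) x + c ord_max *: F ord_max x).
  by apply/funext => x; rewrite big_ord_recr.
move=> x; apply: cvgD; first exact: IH.
by apply: cvgZl_tmp; exact: cF.
Qed.

Lemma banach_iso_of_inverse (f : {linear V -> W}) (g : W -> V) A B :
  continuous f -> continuous g -> closed A -> closed B ->
  (forall x, A x -> B (f x) /\ g (f x) = x) ->
  (forall y, B y -> A (g y) /\ f (g y) = y) -> banach_iso f A B.
Proof.
move=> cf cg clA clB fA gB; split=> //; last 2 first.
- exact: continuous_subspaceT.
- exists g; last exact: continuous_subspaceT.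
  by move=> x /set_mem /fA[].
split=> [x /fA[]//|x y /set_mem/fA[_ xE] /set_mem/fA[_ yE] xy|y /gB[Ag gE]].
  by rewrite -xE xy.
by exists (g y).
Qed.

End Closedness.

(** * The algebra of a pair whose range R(S) is stable *)

Section StableRange.
Context {K : numFieldType} {X Y : lmodType K}.
Context (S T' : {linear X -> Y}) (T : {linear Y -> X}) (U : Y -> Y).

Local Notation B := (range S).
Local Notation A := (T @` range S).
Local Notation N := (null_space S `&` range T).

Definition inverts_on_range : Prop :=
  forall b, B b -> [/\ B (U b), S (T (U b)) = b & U (S (T b)) = b].

(** The part annihilated by ST of the complement ker (1 - T'T) of N(T). *)
Definition tilde_complement : set Y := [set y | T' (T y) = y /\ S (T y) = 0].

Local Notation Yt := tilde_complement.

Lemma subspace_tilde_complement : linear_subspace Yt.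
Proof.
apply/linear_subspaceP; split; first by split; rewrite !linear0.
move=> a u v [uE u0] [vE v0]; split; first by rewrite !linearP uE vE.
by rewrite !linearP u0 v0 scaler0 addr0.
Qed.

Context (UP : inverts_on_range) (TP : T =1 T \o T' \o T).

Lemma inverse_on_range0 : U 0 = 0.
Proof.
have [|_ _] := UP (b := 0); last by rewrite !linear0.
exact: subspace0 (subspace_range _).
Qed.

Lemma null_range_trivial x : A x -> S x = 0 -> x = 0.
Proof.
move=> [b /UP[_ _ bE] <-] STb; move: bE; rewrite STb inverse_on_range0 => <-.
exact: linear0.
Qed.

Lemma range_null_trivial b : B b -> T b = 0 -> b = 0.
Proof. by move=> /UP[_ _ bE] Tb; rewrite -bE Tb linear0 inverse_on_range0. Qed.

(** The map TUS is the projection of X onto T(R(S)) along N(S). *)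
Lemma source_decomposition : direct_sum setT [:: null_space S; A].
Proof.
apply: direct_sum2 => [|||x Sx /null_range_trivial]; last exact.
- exact: subspace_kernel.
- exact/subspace_image/subspace_range.
apply/seteqP; split=> // x _.
have [BU SE _] := UP (imageT S x).
exists (x - T (U (S x))); first by rewrite /null_space /= linearB SE subrr.
by exists (T (U (S x))); [exists (U (S x))|rewrite subrK].
Qed.

Lemma range_decomposition : direct_sum (range T) [:: N; A].
Proof.
apply: direct_sum2 => [|||x [Sx _] /null_range_trivial]; last exact.
- by apply: subspaceI; [exact: subspace_kernel|exact: subspace_range].
- exact/subspace_image/subspace_range.
have AT : A `<=` range T by move=> _ [b _ <-]; exists b.
apply/seteqP; split=> [x Tx|_ [n [_ Tn] [a /AT Ta <-]]]; last first.
  exact: subspaceD (subspace_range _) _ _.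
have [BU SE _] := UP (imageT S x).
have Aa : A (T (U (S x))) by exists (U (S x)).
exists (x - T (U (S x))); last by exists (T (U (S x))); rewrite ?subrK.
split; first by rewrite /null_space /= linearB SE subrr.
exact: subspaceB (subspace_range _) Tx (AT _ Aa).
Qed.

(** Subtracting b = U(ST(y)) from y achieves ST(y - b) = 0, after which T'T
    projects y - b onto the last summand along N(T). *)
Lemma target_decomposition : direct_sum setT [:: null_space T; B; Yt].
Proof.
have lT := subspace_kernel T; have lB := subspace_range S.
apply: (direct_sum_refine (B := add_set (null_space T) B)) => //; last first.
  by apply: direct_sum2 => // x Tx /range_null_trivial; apply.
apply: direct_sum2 => //.
- exact: subspace_add.
- exact: subspace_tilde_complement.
- apply/seteqP; split=> // y _.
  have [BU SE _] := UP (imageT S (T y)); set b := U (S (T y)) in BU SE.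
  exists ((y - b) - T' (T (y - b)) + b).
    exists ((y - b) - T' (T (y - b))); last by exists b.
    by rewrite /null_space /= linearB {1}TP subrr.
  exists (T' (T (y - b))); last by rewrite addrAC subrK subrK.
  have TT z : T (T' (T z)) = T z by rewrite [RHS]TP.
  by split; rewrite TT // !linearB SE subrr.
move=> y [t Tt [b Bb yE]] [TTy STy].
have b0 : b = 0.
  have [_ _ <-] := UP Bb; suff -> : S (T b) = 0 by exact: inverse_on_range0.
  by move: STy; rewrite -yE linearD Tt add0r.
by rewrite -TTy -yE b0 addr0 Tt linear0.
Qed.

Lemma image_tilde_complement : T @` Yt = N.
Proof.
apply/seteqP; split=> [_ [y [_ STy] <-]|x [Sx [y _ xE]]].
  by split=> //; exists y.
have TTx : T (T' x) = x by rewrite -xE [RHS]TP.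
by exists (T' x); [split; rewrite TTx|].
Qed.

Lemma null_meets_range : null_space T `&` B = [set 0].
Proof.
apply/seteqP; split=> [y [Ty By]|_ ->]; first exact: range_null_trivial.
by split; [exact: linear0|exact: subspace0 (subspace_range _)].
Qed.

Lemma image_range_meets_null : A `&` null_space S = [set 0].
Proof.
apply/seteqP; split=> [x [Ax Sx]|_ ->]; first exact: null_range_trivial.
split; last exact: linear0.
exact: subspace0 (subspace_image _ (subspace_range _)).
Qed.

Lemma image_range_fixpoints : A = [set x | T (U (S x)) = x].
Proof.
apply/seteqP; split=> [_ [b /UP[_ _ bE] <-] /=|x /= <-]; first by rewrite bE.
by exists (U (S x)) => //; have [] := UP (imageT S x).
Qed.

Lemma range_fixpoints : B = [set y | S (T (U y)) = y].
Proof. by apply/seteqP; split=> y /= => [/UP[]//|<-]; exists (T (U y)). Qed.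

Lemma null_range_fixpoints :
  N = [set x | S x = 0] `&` [set x | T (T' x) = x].
Proof.
congr (_ `&` _); apply/seteqP; split=> [_ [y _ <-]|x <-]; last by exists (T' x).
by rewrite /= [RHS]TP.
Qed.

End StableRange.

(** * The system attached to a stable range *)

Section StableRangeSystem.
Context {K : numFieldType} {X Y : normedModType K}.
Context (S : {linear X -> Y}) (T : {linear Y -> X}).

(** U is a polynomial in ST, whence its continuity and its stability on the
    range of S. *)
Lemma range_inverse :
  continuous S -> continuous T -> fredholm_pair S T ->
  S @` range T = range S -> S @` (T @` range S) = range S ->
  exists2 U : Y -> Y, continuous U & inverts_on_range S T U.
Proof.
move=> cS cT [_ [m [e [_ TE]]] _ _] STE STSE.
(* As S kills N(S), its range is spanned by the images of representatives of
   R(T) modulo N(S) /\ R(T). *)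
have fB : finite_dim (range S).
  suff -> : range S = S @` (span_of e).
    by apply: finite_dim_image; do 2 eexists.
  rewrite -STE TE; apply/seteqP; split.
    move=> _ [_ [x [Sx _] [z ez <-]] <-]; exists z => //.
    by rewrite linearD Sx add0r.
  move=> _ [z ez <-]; exists z => //.
  exists 0; last by exists z; rewrite ?add0r.
  by split; [exact: linear0|exists 0; rewrite ?linear0].
pose f : {linear Y -> Y} := S \o T.
have fBE : f @` range S = range S.
  exact: etrans (esym (image_comp T S _)) STSE.
have [n [c cP]] := surjective_inverse_poly fB fBE.
have cf k : continuous (iter k f).
  elim: k => [|k IH]; first by move=> y; exact: cvg_id.
  apply: (continuous_compose (f := iter k f) (g := f)) => //.
  exact: continuous_compose cT cS.
exists (fun y => \sum_(k < n) c k *: iter k f y).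
  by apply: continuous_linear_combination => i; exact: cf.
move=> b Bb; have lB := subspace_range S.
split; last 1 first.
- rewrite -[RHS]cP // linear_sum; apply: eq_bigr => k _.
  by rewrite linearZ -iterS iterSr.
- apply: subspace_sum => // k; apply: subspaceZ => //.
  by elim: (nat_of_ord k) => //= j [x _ <-]; exists (T (S x)).
- exact: cP.
Qed.

End StableRangeSystem.

Section StableDecomposition.
Context {K : numFieldType} {X Y : normedModType K}.
Context (S T' : {linear X -> Y}) (T : {linear Y -> X}) (U : Y -> Y).
Context (X1 : set X).

Local Notation B := (range S).
Local Notation A := (T @` range S).
Local Notation N := (null_space S `&` range T).
Local Notation Yt := (tilde_complement S T' T).

Definition stable_decomposition : decomposition X Y :=
  Decomposition X1 A [set 0] (null_space T) B Yt.

Local Notation D := stable_decomposition.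

Context (cS : continuous S) (cT : continuous T) (cT' : continuous T').
Context (cU : continuous U) (UP : inverts_on_range S T U).
Context (TP : T =1 T \o T' \o T) (FST : fredholm_pair S T).
Context (RSE : forall n, RS S T n.+1 = range S).
Context (lX1 : linear_subspace X1) (fX1 : finite_dim X1).
Context (X1P : direct_sum (null_space S) [:: N; X1]).

Let lB : linear_subspace B := subspace_range S.
Let lA : linear_subspace A := subspace_image T lB.
Let lN : linear_subspace N :=
  subspaceI (subspace_kernel S) (subspace_range T).
Let lYt : linear_subspace Yt := subspace_tilde_complement S T' T.

Lemma image_zero (V W : lmodType K) (f : {linear V -> W}) :
  f @` [set 0] = [set 0].
Proof. by rewrite image_set1 linear0. Qed.

Lemma RTE n : RT S T n.+2 = A.
Proof. by rewrite -[LHS]/(T @` RS S T n.+1) RSE. Qed.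

Lemma RTt1 : RTt S T D 1 = N.
Proof. exact: image_tilde_complement. Qed.

(** S kills the range N of T on Y~, so the sequence dies at once in Y; every
    later step applies S T to the zero subspace. *)
Lemma RStE n : RSt S T D n.+1 = [set 0].
Proof.
suff [] : RSt S T D n.+1 = [set 0] /\ RSt S T D n.+2 = [set 0] by [].
elim: n => [|n [IH1 IH2]]; last first.
  by split=> //; rewrite -[LHS]/(S @` (T @` RSt S T D n.+1)) IH1 !image_zero.
split; first exact: image_zero.
rewrite -[LHS]/(S @` RTt S T D 1) RTt1.
apply/seteqP; split=> [_ [x [Sx _] <-]//|_ ->].
by exists 0; [exact: subspace0|exact: linear0].
Qed.

Lemma RTtE n : RTt S T D n.+2 = [set 0].
Proof. by rewrite -[LHS]/(T @` RSt S T D n.+1) RStE image_zero. Qed.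

Lemma YtNE : YtN S T D = Yt.
Proof.
rewrite /YtN /Nnt RTt1 -(image_tilde_complement S TP).
apply/seteqP; split=> [y []//|y Yy].
by split=> //; split; [exists y|case: Yy].
Qed.

Lemma NntE : Nnt S T D 1 = N.
Proof. by rewrite /Nnt RTt1 setIC setIA setIid. Qed.

Lemma Y2nE : Y2n S T D 2 = B.
Proof. by rewrite /Y2n RSE setIid. Qed.

Lemma X2nE : X2n S T D 2 = A.
Proof. by rewrite /X2n RTE setIid. Qed.

Lemma closed_range : closed B.
Proof.
rewrite (range_fixpoints UP); apply: (closed_fixpoints (f := S \o (T \o U))).
by do 2 apply: continuous_compose => //.
Qed.

Lemma closed_image_range : closed A.
Proof.
rewrite (image_range_fixpoints UP).
apply: (closed_fixpoints (f := T \o (U \o S))).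
by do 2 apply: continuous_compose => //.
Qed.

Lemma closed_null_range : closed N.
Proof.
rewrite (null_range_fixpoints S TP); apply: closedI; first exact: closed_kernel.
by apply: (closed_fixpoints (f := T \o T')); exact: continuous_compose.
Qed.

Lemma closed_tilde_complement : closed Yt.
Proof.
have cST : continuous (S \o T) by exact: continuous_compose.
apply: closedI; last exact: (closed_kernel cST).
by apply: (closed_fixpoints (f := T' \o T)); exact: continuous_compose.
Qed.

Lemma iso_image_range : banach_iso S A B.
Proof.
apply: (banach_iso_of_inverse (g := T \o U)) => //.
- exact: continuous_compose.
- exact: closed_image_range.
- exact: closed_range.
- move=> _ [b Bb <-]; have [_ _ bE] := UP Bb.
  by split; [exists (T b)|rewrite /= bE].
by move=> b /UP[BU bE _]; split=> //; exists (U b).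
Qed.

Lemma iso_range_image : banach_iso T B A.
Proof.
apply: (banach_iso_of_inverse (g := U \o S)) => //.
- exact: continuous_compose.
- exact: closed_range.
- exact: closed_image_range.
- by move=> b Bb; have [_ _ bE] := UP Bb; split=> //; exists b.
by move=> _ [b Bb <-]; have [_ _ bE] := UP Bb; rewrite /= bE.
Qed.

Lemma iso_tilde_null : banach_iso T Yt N.
Proof.
have TYt := image_tilde_complement S TP.
apply: (banach_iso_of_inverse (g := T')) => //.
- exact: closed_tilde_complement.
- exact: closed_null_range.
- by move=> y Yy; split; [rewrite -TYt; exists y|case: Yy].
by rewrite -TYt => _ [y Yy <-]; case: (Yy) => -> _.
Qed.

Lemma finite_dim_range : finite_dim B.
Proof.
case: FST => _ _ _ [m [e [_ RE]]].
by rewrite RE (null_meets_range UP) add_set0l; do 2 eexists.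
Qed.

Lemma finite_dim_kernel : finite_dim (null_space T).
Proof.
case: FST => _ _ [m [e [_ ->]]] _.
by rewrite (null_meets_range UP) add_set0l; do 2 eexists.
Qed.

Lemma stable_decomposition_system : is_decomposition_system S T D.
Proof.
have lNT := subspace_kernel T.
have fB := finite_dim_range; have fNT := finite_dim_kernel.
split.
- by [].
- by split=> //; exact: finite_dim_image.
- split; [exact: subspace_set0|exact: closed_zero|by []|].
  exact: closed_tilde_complement.
- split; [by []|exact: range_decomposition UP|].
  apply/(direct_sum_rcons0 _ [:: N; X1; A]).
  exact: direct_sum_refine lN lX1 (source_decomposition UP) X1P.
rewrite (null_meets_range UP); split; try exact: direct_sum_0l.
by apply/direct_sum_cons0 => //; exact: target_decomposition UP TP.
Qed.

Lemma stable_decomposition_adapted : adapted S T D.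
Proof.
have AT : A `<=` range T by move=> _ [b _ <-]; exists b.
have NS : N `<=` null_space S by move=> x [].
have NA : N `&` A = [set 0].
  by rewrite -setIA (setIidr AT) setIC; exact: image_range_meets_null UP.
have meet0 (V : lmodType K) (Z : set V) :
    linear_subspace Z -> [set 0] `&` Z = [set 0].
  by move=> lZ; apply/setIidl => _ ->; exact: subspace0.
move=> [//|n] _; split.
- rewrite /Mn /Y2n RSE setIid setIC (null_meets_range UP).
  exact: direct_sum_0l.
- case: n => [|n].
    rewrite /Nn /X2n /RT -/(range T) setIC (setIidr AT).
    exact: range_decomposition UP.
  rewrite /Nn /X2n RTE setIid (image_range_meets_null UP).
  exact: direct_sum_0l.
- rewrite /Mnt /Y2nt /Y2n RSE setIid RStE !meet0 //; last first.
    exact: subspace_kernel.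
  exact: direct_sum_0l subspace_set0.
- case: n => [|n].
    rewrite /Nnt /X2nt /X2n RTt1 /RT -/(range T) (setIidr AT) (setIidl NS) NA.
    exact: direct_sum_0r.
  rewrite /Nnt /X2nt /X2n RTE setIid RTtE !meet0 //; last first.
    exact: subspace_kernel.
  exact: direct_sum_0l subspace_set0.
split; first by rewrite !RSE RStE; exact: direct_sum_0r.
case: n => [|n]; last by rewrite !RTE RTtE; exact: direct_sum_0r.
by rewrite RTE RTt1; apply: direct_sum_swap; exact: range_decomposition UP.
Qed.

Lemma complement_vanishes : vanishes_on S X1.
Proof.
move=> x X1x; suff : null_space S x by [].
case: X1P => -> _; exists 0; first exact: subspace0.
by exists x; rewrite /= ?add0r // add_set0.
Qed.

Lemma stable_range_case_II :
  [/\ direct_sum setT [:: X1; Nnt S T D 1; X2n S T D 2],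
      direct_sum setT [:: null_space T; Y2n S T D 2; YtN S T D],
      vanishes_on S (add_set X1 (Nnt S T D 1)) /\
        banach_iso S (X2n S T D 2) (Y2n S T D 2) &
      [/\ vanishes_on T (null_space T),
          banach_iso T (Y2n S T D 2) (X2n S T D 2) &
          banach_iso T (YtN S T D) (Nnt S T D 1)]].
Proof.
rewrite X2nE Y2nE NntE YtNE; split.
- apply: (direct_sum_refine lX1 lN (source_decomposition UP)).
  exact: direct_sum_swap.
- exact: target_decomposition UP TP.
- split; last exact: iso_image_range.
  move=> _ [x X1x [n [Sn _] <-]].
  by rewrite linearD Sn addr0 complement_vanishes.
by split; [|exact: iso_range_image|exact: iso_tilde_null].
Qed.

Lemma stable_range_case_I : RT S T 1 = RT S T 2 ->
  [/\ direct_sum setT [:: X1; X2n S T D 2],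
      direct_sum setT [:: null_space T; Y2n S T D 2],
      vanishes_on S X1 /\ banach_iso S (X2n S T D 2) (Y2n S T D 2) &
      vanishes_on T (null_space T) /\
        banach_iso T (Y2n S T D 2) (X2n S T D 2)].
Proof.
rewrite RTE X2nE Y2nE => TA.
have N0 : N = [set 0].
  by rewrite -[range T]/(RT S T 1) TA setIC (image_range_meets_null UP).
have Yt0 : Yt = [set 0].
  apply/seteqP; split=> [y Yy|_ ->]; last exact: subspace0.
  have : N (T y) by rewrite -(image_tilde_complement S TP); exists y.
  by rewrite N0 => Ty0; case: Yy => TTy _; rewrite -TTy Ty0; exact: linear0.
split.
- have := direct_sum_refine lN lX1 (source_decomposition UP) X1P.
  by rewrite N0 => /direct_sum_cons0; apply.
- have := target_decomposition UP TP.
  by rewrite Yt0 => /(direct_sum_rcons0 _ [:: null_space T; B]).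
- by split; [exact: complement_vanishes|exact: iso_image_range].
by split; last exact: iso_range_image.
Qed.

End StableDecomposition.

Section Existence.
Context {K : numFieldType} {X Y : normedModType K}.
Context (S : {linear X -> Y}) (T : {linear Y -> X}).

Lemma stable_range_system :
  regular_fredholm_pair S T -> (forall n, RS S T n.+1 = range S) ->
  exists D : decomposition X Y,
    [/\ is_decomposition_system S T D,
        adapted S T D,
        RT S T 1 = RT S T 2 ->
          [/\ direct_sum setT [:: dX1 D; X2n S T D 2],
              direct_sum setT [:: dY1 D; Y2n S T D 2],
              vanishes_on S (dX1 D) /\
                banach_iso S (X2n S T D 2) (Y2n S T D 2) &
              vanishes_on T (dY1 D) /\
                banach_iso T (Y2n S T D 2) (X2n S T D 2)] &
        [/\ direct_sum setT [:: dX1 D; Nnt S T D 1; X2n S T D 2],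
              direct_sum setT [:: dY1 D; Y2n S T D 2; YtN S T D],
              vanishes_on S (add_set (dX1 D) (Nnt S T D 1)) /\
                banach_iso S (X2n S T D 2) (Y2n S T D 2) &
              [/\ vanishes_on T (dY1 D),
                  banach_iso T (Y2n S T D 2) (X2n S T D 2) &
                  banach_iso T (YtN S T D) (Nnt S T D 1)]]].
Proof.
move=> [/linear_bounded_continuous cS /linear_bounded_continuous cT FST _].
move=> [T' /linear_bounded_continuous cT' TP] RSE.
have [U cU UP] := range_inverse cS cT FST (RSE 1) (RSE 2).
have [X1 [lX1 fX1 X1P]] : exists C, [/\ linear_subspace C, finite_dim C &
    direct_sum (null_space S) [:: null_space S `&` range T; C]].
  case: FST => NS _ _ _; apply: finite_dim_quot_complement NS.
  exact: subspaceI (subspace_kernel S) (subspace_range T).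
exists (stable_decomposition S T' T X1); split.
- exact: (stable_decomposition_system (U := U)).
- exact: (stable_decomposition_adapted (U := U)).
- exact: (stable_range_case_I (U := U)).
exact: (stable_range_case_II (U := U)).
Qed.

End Existence.

(** * Exchanging the two operators *)

Section Swap.
Context {K : numFieldType} {X Y : normedModType K}.

Lemma regular_fredholm_pair_sym (S : {linear X -> Y}) (T : {linear Y -> X}) :
  regular_fredholm_pair S T -> regular_fredholm_pair T S.
Proof. by move=> [bS bT [F1 F2 F3 F4] rS rT]; split. Qed.

Definition swap_decomposition (D : decomposition Y X) : decomposition X Y :=
  Decomposition (dY1 D) (dY2 D) (dYt D) (dX1 D) (dX2 D) (dXt D).

Lemma is_decomposition_system_swap (S : X -> Y) (T : Y -> X) D :
  is_decomposition_system T S D ->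
  is_decomposition_system S T (swap_decomposition D).
Proof. by move=> [[? ? ? ?] [? ? ? ?] [? ? ? ?] ? ?]; split. Qed.

Lemma adapted_swap (S : X -> Y) (T : Y -> X) D :
  adapted T S D -> adapted S T (swap_decomposition D).
Proof. by move=> aD n /aD[? ? ? ? [? ?]]; split. Qed.

End Swap.

Lemma stabilization_index_uniq (V : Type) (F : nat -> set V) p p' :
  stabilization_index F p -> stabilization_index F p' -> p = p'.
Proof.
by move=> [Fp pmin] [Fp' p'min]; apply/eqP; rewrite eqn_leq pmin // p'min.
Qed.

Theorem theorem3p9 (K : numFieldType) (hK : real_or_complex K)
    (X Y : completeNormedModType K)
    (S : {linear X -> Y}) (T : {linear Y -> X})
    (hST : regular_fredholm_pair S T) (hnum : has_number S T 1) :
  exists D : decomposition X Y,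
    [/\ is_decomposition_system S T D,
        adapted S T D,
        has_case S T CaseI 1 ->
          [/\ direct_sum setT [:: dX1 D; X2n S T D 2],
              direct_sum setT [:: dY1 D; Y2n S T D 2],
              vanishes_on S (dX1 D) /\
                banach_iso S (X2n S T D 2) (Y2n S T D 2) &
              vanishes_on T (dY1 D) /\
                banach_iso T (Y2n S T D 2) (X2n S T D 2)],
        has_case S T CaseII 1 ->
          [/\ direct_sum setT [:: dX1 D; Nnt S T D 1; X2n S T D 2],
              direct_sum setT [:: dY1 D; Y2n S T D 2; YtN S T D],
              vanishes_on S (add_set (dX1 D) (Nnt S T D 1)) /\
                banach_iso S (X2n S T D 2) (Y2n S T D 2) &
              [/\ vanishes_on T (dY1 D),
                  banach_iso T (Y2n S T D 2) (X2n S T D 2) &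
                  banach_iso T (YtN S T D) (Nnt S T D 1)]] &
        has_case S T CaseIII 1 ->
          [/\ direct_sum setT [:: dX1 D; X2n S T D 2; XtN S T D],
              direct_sum setT [:: dY1 D; Mnt S T D 1; Y2n S T D 2],
              [/\ vanishes_on S (dX1 D),
                  banach_iso S (X2n S T D 2) (Y2n S T D 2) &
                  banach_iso S (XtN S T D) (Mnt S T D 1)] &
              vanishes_on T (add_set (dY1 D) (Mnt S T D 1)) /\
                banach_iso T (Y2n S T D 2) (X2n S T D 2)]].
Proof.
have [p [q [[pP qP] pq1]]] := hnum.
have p_gt0 : (0 < p)%N by case: pP => -[].
have q_gt0 : (0 < q)%N by case: qP => -[].
have caseE c : has_case S T c 1 -> c = case_of_indices p q.
  move=> [p' [q' [[p'P q'P] _ ->]]].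
  rewrite (stabilization_index_uniq p'P pP).
  by rewrite (stabilization_index_uniq q'P qP).
have RS_stable (p1 : p = 1%N) n : RS S T n.+1 = range S.
  by case: pP => -[_ stab] _; move: (stab n); rewrite p1 => /esym.
have RT_stable (q1 : q = 1%N) n : RT S T n.+1 = range T.
  by case: qP => -[_ stab] _; move: (stab n); rewrite q1 => /esym.
have [p1|p_neq1] := eqVneq p 1%N.
  have [D [dD aD c1 c2]] := stable_range_system hST (RS_stable p1).
  exists D; split=> // [/caseE|/caseE].
    rewrite /case_of_indices; case: eqP => [pq _|_]; last by case: ifP.
    by apply: c1; rewrite !RT_stable // -pq.
  by rewrite /case_of_indices p1; case: eqP => // ?; case: ifP => //; lia.
(* Here p > 1 = q: case II of the exchanged pair is case III of (S, T). *)
have q1 : q = 1%N by lia.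
have [D [dD aD c1 c2]] :=
  stable_range_system (regular_fredholm_pair_sym hST) (RT_stable q1).
exists (swap_decomposition D); split.
- exact: is_decomposition_system_swap.
- exact: adapted_swap.
- move=> /caseE; rewrite /case_of_indices.
  by case: eqP => [|_]; [lia|case: ifP].
- move=> /caseE; rewrite /case_of_indices; case: eqP => // _.
  by case: ifP => //; lia.
by move=> _; case: c2 => [? ? [? ?] [? ? ?]]; split.
Qed.
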